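(* Starting with $n$ ordered cards and performing a single riffle shuffle, let $P_n$ be the number of remaining cards, divided by two, when the first pure luck guess with only a $50$ percent success chance occurs. Then $P_n$ has a $\beta\big(\frac12,\frac12\big)$ limit law (Arcsine distribution): as $n\to\infty$, $$\frac{P_n}{\frac{n}{2}}\to\beta\big(\tfrac12,\tfrac12\big)$$ in distribution, where $\beta(\frac12,\frac12)$ is the Beta distribution with parameters $\frac12,\frac12$, with density $\frac{1}{\pi}\frac{1}{\sqrt{x(1-x)}}$, $0<x<1$.
   Context: One-time riffle shuffle (Gilbert–Shannon–Reeds model): an ordered deck $1,2,\dots,n$ is cut after the first $k$ cards with probability $\binom{n}{k}/2^n$, $0\le k\le n$, and the two packets $1,\dots,k$ and $k+1,\dots,n$ are interleaved uniformly at random, keeping the relative order within each packet. Equivalently: choose a word $w\in\{a,b\}^n$ uniformly at random among the $2^n$ words; if $w$ has $k$ letters $a$, replace the $a$'s from left to right by $1,2,\dots,k$ and the $b$'s from left to right by $k+1,\dots,n$; the resulting sequence is the shuffled deck read from top to bottom. Guessing game with complete feedback: the cards are drawn one after another from the top; before each draw the guesser guesses the label of the next card, and then the drawn card is shown. The guesser uses the optimal strategy: as long as all previous guesses were correct, the guesser guesses label $j$ for the $j$-th card (first phase; in this phase the conditional success probability always exceeds $50$ percent). When this fails for the first time, say the $j$-th card has label $m>j$, the cut is known to have been at $m-1$, and the remaining cards form an interleaving of the two increasing sequences $j,j+1,\dots,m-1$ and $m+1,\dots,n$; from then on the guesser always guesses the smallest remaining label of the currently longer of the two remaining sequences (in case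 of equal lengths, either choice). A pure luck guess is a guess whose conditional success probability, given the information available to the guesser, is exactly $50$ percent; this happens exactly when, in the second phase, the two remaining sequences have equal positive length $h$, i.e. $2h$ cards remain. $P_n$ is the value of $h$ at the first such guess, and $P_n=0$ if no such guess occurs. *)

(* Defs.v *)
From HB Require Import structures.
From mathcomp Require Import all_boot all_order all_algebra.
From mathcomp Require Import all_classical all_reals all_analysis.
From mathcomp Require Import measurable_realfun ring lra.

Set Implicit Arguments.
Unset Strict Implicit.
Unset Printing Implicit Defensive.

Import Order.TTheory GRing.Theory Num.Theory.
Import numFieldNormedType.Exports.

Local Open Scope classical_set_scope.
Local Open Scope ring_scope.

Definition cvg_in_distribution (R : realType)
    (mu_ : nat -> probability R R)
    (mu : probability R R) : Prop :=
  forall x : R, {for x, continuous (fun r : R => mu `]-oo, r]%classic)} ->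
    mu_ n `]-oo, x]%classic @[n --> \oo] --> mu `]-oo, x]%classic.

(* Only meaningful when P B != 0 (its value is 0 otherwise). *)
Definition cond_prob d (T : measurableType d) (R : realType)
    (P : probability T R) (A B : set T) : R :=
  fine (P (A `&` B)) / fine (P B).

Section arcsine.
Context {R : realType}.
Local Notation mu := (@lebesgue_measure R).

(* The density of beta(1/2,1/2); the library's beta_pdf only has natural
   number parameters. *)
Definition arcsine_pdf (x : R) : R :=
  if 0 < x < 1 then (pi * Num.sqrt (x * (1 - x)))^-1 else 0.

Definition arcsine_prob (A : set R) : \bar R :=
  (\int[mu]_(x in A) (arcsine_pdf x)%:E)%E.

Lemma arcsine_pdf_ge0 x : 0 <= arcsine_pdf x.
Proof.
rewrite /arcsine_pdf; case: ifP => // _.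
by rewrite invr_ge0 mulr_ge0 ?pi_ge0 ?sqrtr_ge0.
Qed.

Let raw_continuous (x : R) : 0 < x < 1 ->
  (pi * Num.sqrt (y * (1 - y)))^-1 @[y --> x] -->
  (pi * Num.sqrt (x * (1 - x)))^-1.
Proof.
move=> /andP[x0 x1].
have sx : 0 < Num.sqrt (x * (1 - x)) by rewrite sqrtr_gt0 mulr_gt0// subr_gt0.
apply: cvgV; first by rewrite mulf_neq0 ?gt_eqF ?pi_gt0.
apply: cvgMl_tmp.
apply: (@continuous_comp _ _ _ (fun y : R => y * (1 - y)) Num.sqrt);
  last exact: sqrt_continuous.
by apply: cvgM; [exact: cvg_id|apply: cvgB; [exact: cvg_cst|exact: cvg_id]].
Qed.

Lemma arcsine_pdf_continuous x : 0 < x < 1 ->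
  {for x, continuous arcsine_pdf}.
Proof.
move=> x01; rewrite /prop_for /continuous_at.
have -> : arcsine_pdf x = (pi * Num.sqrt (x * (1 - x)))^-1.
  by rewrite /arcsine_pdf x01.
apply: cvg_trans (raw_continuous x01).
apply: near_eq_cvg; have xi : x \in `]0, 1[ by rewrite in_itv.
near=> y; rewrite /arcsine_pdf.
have -> // : 0 < y < 1.
have: y \in `]0, 1[ by near: y; exact: near_in_itvoo.
by rewrite in_itv.
Unshelve. all: by end_near. Qed.

Lemma measurable_arcsine_pdf : measurable_fun [set: R] arcsine_pdf.
Proof.
rewrite (_ : arcsine_pdf =
    (fun x => (pi * Num.sqrt (x * (1 - x)))^-1) \_ `]0, 1[ :> (R -> R)); last first.
  by apply/funext => x; rewrite patchE /arcsine_pdf mem_setE in_itv.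
apply/measurable_restrict => //; rewrite setTI.
apply: open_continuous_measurable_fun; first exact: interval_open.
by move=> x; rewrite inE/= in_itv/= => /raw_continuous.
Qed.

Lemma arcsine_pdfE x : 0 < x < 1 ->
  arcsine_pdf x = (pi^-1 * 2) * (Num.sqrt (1 - (2 * x - 1) ^+ 2))^-1.
Proof.
move=> x01; rewrite /arcsine_pdf x01.
have -> : 1 - (2 * x - 1) ^+ 2 = 2 ^+ 2 * (x * (1 - x)) by ring.
rewrite (sqrtrM _ (sqr_ge0 2)) sqrtr_sqr (@ger0_norm _ 2)// !invfM.
by rewrite -mulrA mulVKf.
Qed.

Lemma arcsine_prob_itv (a b : R) : 0 < a -> a < b -> b < 1 ->
  arcsine_prob `[a, b] =
  (pi^-1 * asin (2 * b - 1) - pi^-1 * asin (2 * a - 1))%:E.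
Proof.
move=> a0 ab b1.
pose F (x : R) := pi^-1 * asin (2 * x - 1).
have dF (x : R) : 0 < x < 1 -> is_derive x 1 F (arcsine_pdf x).
  move=> x01; rewrite arcsine_pdfE//.
  have ? : is_derive (2 * x - 1) 1 (@asin R)
      (Num.sqrt (1 - (2 * x - 1) ^+ 2))^-1.
    by apply: is_derive1_asin; move: x01 => /andP[? ?]; apply/andP; split; lra.
  have h : is_derive x 1 (fun y : R => 2 * y - 1) 2.
    by apply: is_derive_eq; rewrite ?scaler0 ?addr0 ?add0r ?subr0 /GRing.scale/= ?mulr1.
  apply: is_derive_eq.
  by rewrite /GRing.scale/= -mulrA; congr (_ * _); exact: mulrC.
have cF (x : R) : 0 < x < 1 -> {for x, continuous F}.
  move=> /dF dFx; apply: differentiable_continuous.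
  exact/derivable1_diffP/ex_derive.
rewrite /arcsine_prob (@continuous_FTC2 _ arcsine_pdf F a b) //.
- apply/subspace_continuousP => x /=; rewrite in_itv/= => /andP[ax xb].
  apply: cvg_within_filter; apply: arcsine_pdf_continuous.
  by rewrite (lt_le_trans a0)//= (le_lt_trans xb).
- split.
  + move=> x; rewrite in_itv/= => /andP[ax xb]; apply: ex_derive.
    apply: (dF x).
    by rewrite (lt_trans a0)//= (lt_trans xb).
  + apply: cvg_at_right_filter; apply: cF.
    by rewrite a0 (lt_trans ab).
  + apply: cvg_at_left_filter; apply: cF.
    by rewrite b1 (lt_trans a0).
- move=> x; rewrite in_itv/= => /andP[ax xb]; rewrite derive1E.
  apply: derive_val; apply: dF.
  by rewrite (lt_trans a0)//= (lt_trans xb).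
Qed.

Let arcsine0 : arcsine_prob set0 = 0%E.
Proof. by rewrite /arcsine_prob integral_set0. Qed.

Let arcsine_ge0 A : (0 <= arcsine_prob A)%E.
Proof. by apply: integral_ge0 => /= x _; rewrite lee_fin arcsine_pdf_ge0. Qed.

Let arcsine_sigma_additive : semi_sigma_additive arcsine_prob.
Proof.
move=> /= F mF tF mUF; rewrite /arcsine_prob; apply: cvg_toP.
  apply: ereal_nondecreasing_is_cvgn => m n mn.
  apply: lee_sum_nneg_natr => // k _ _.
  by apply: integral_ge0 => /= x Fkx; rewrite lee_fin arcsine_pdf_ge0.
rewrite ge0_integral_bigcup//=.
- apply: measurable_funTS; apply: measurableT_comp => //.
  exact: measurable_arcsine_pdf.
- by move=> x _; rewrite lee_fin arcsine_pdf_ge0.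
Qed.

HB.instance Definition _ := isMeasure.Build _ _ _ arcsine_prob
  arcsine0 arcsine_ge0 arcsine_sigma_additive.

Let arcsine_setT : arcsine_prob [set: _] = 1%:E.
Proof.
pose t n : R := pi / 2 * (1 - n.+2%:R^-1).
have invn n : 0 < (n.+2%:R^-1 : R) < 1.
  by rewrite invr_gt0 ltr0n/= invf_lt1 ?ltr0n// ltr1n.
have pi0 : 0 < pi :> R := pi_gt0 R.
have t_itv n : 0 < t n < pi / 2.
  have /andP[i0 i1] := invn n; rewrite /t; apply/andP; split; first by rewrite mulr_gt0 ?divr_gt0 ?subr_gt0.
  by rewrite gtr_pMr ?divr_gt0//; lra.
have t_in n : t n \in `[- (pi / 2), pi / 2].
  by have /andP[? ?] := t_itv n; rewrite in_itv/=; apply/andP; split; lra.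
have tN_in n : - t n \in `[- (pi / 2), pi / 2].
  by have /andP[? ?] := t_itv n; rewrite in_itv/=; apply/andP; split; lra.
have s0 n : 0 < sin (t n) by exact: sin_gt0_pihalf.
have s1 n : sin (t n) < 1.
  rewrite lt_neqAle sin_le1 andbT; apply/eqP; rewrite -sin_pihalf => /sin_inj.
  have /andP[t0 t1] := t_itv n.
  move=> e; move: t1; rewrite e ?ltxx//.
  by rewrite in_itv/= lexx andbT; lra.
pose F n : set R := `[(1 - sin (t n)) / 2, (1 + sin (t n)) / 2]%classic.
have FE n : arcsine_prob (F n) = (1 - n.+2%:R^-1)%:E.
  rewrite arcsine_prob_itv; last 3 first.
  - by have := s1 n; lra.
  - by have := s0 n; lra.
  - by have := s1 n; lra.
  have -> : 2 * ((1 + sin (t n)) / 2) - 1 = sin (t n) by field.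
  have -> : 2 * ((1 - sin (t n)) / 2) - 1 = sin (- t n) by rewrite sinN; field.
  rewrite !sinK//; congr EFin.
  by rewrite mulrN opprK -mulrDr /t -mulrDl -splitr mulrA mulVf ?mul1r// gt_eqF.
have t_le m n : (m <= n)%N -> t m <= t n.
  move=> mn; rewrite /t ler_pM2l ?divr_gt0// lerD2l lerN2 lef_pV2 ?posrE ?ltr0n//.
  by rewrite ler_nat.
have s_le m n : (m <= n)%N -> sin (t m) <= sin (t n).
  move=> /t_le; rewrite le_eqVlt => /predU1P[->//|tmn]; apply: ltW.
  by rewrite ltr_sin.
have ndF : nondecreasing_seq F.
  move=> m n mn; rewrite subsetEset => x; rewrite /F /= !in_itv/=.
  by have := s_le _ _ mn => ? /andP[? ?]; apply/andP; split; lra.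
have UF : \bigcup_n F n = `]0, 1[%classic.
  apply/seteqP; split=> x.
    move=> [n _]; rewrite /F /= !in_itv/=; have := s1 n => ? /andP[? ?].
    by apply/andP; split; lra.
  rewrite /= in_itv/= => /andP[x0 x1].
  pose y := asin (2 * x - 1).
  have yE : 2 * x - 1 = sin y by rewrite asinK// in_itv/=; apply/andP; split; lra.
  have yl : y < pi / 2 by apply: asin_ltpi2; apply/andP; split; lra.
  have yg : - (pi / 2) < y by apply: asin_gtNpi2; apply/andP; split; lra.
  have : \forall n \near \oo, (n.+1%:R^-1 : R) < 1 - `|y| / (pi / 2).
    have : 0 < 1 - `|y| / (pi / 2).
      by rewrite subr_gt0 ltr_pdivrMr ?divr_gt0// mul1r ltr_norml yg.
    move=> e0; exact: (near_infty_natSinv_lt (PosNum e0)).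
  move=> [N _ HN]; exists N => //.
  have := HN N.+1 (leqnSn N) => /= HN1.
  have yt : `|y| <= t N.
    rewrite /t mulrC -ler_pdivrMr ?divr_gt0//.
    by rewrite lerBrDr addrC -lerBrDr ltW.
  move: yt; rewrite ler_norml => /andP[yt1 yt2].
  have y_in : y \in `[- (pi / 2), pi / 2] by rewrite in_itv/= !ltW.
  have h1 : sin y <= sin (t N).
    by move: yt2; rewrite le_eqVlt => /predU1P[->//|?]; rewrite ltW// ltr_sin.
  have h2 : sin (- t N) <= sin y.
    by move: yt1; rewrite le_eqVlt => /predU1P[->//|?]; rewrite ltW// ltr_sin.
  move: h2; rewrite sinN => h2.
  by rewrite /F /= in_itv/=; apply/andP; split; lra.
have -> : arcsine_prob [set: _] = arcsine_prob `]0, 1[%classic.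
  rewrite /arcsine_prob [RHS]integral_mkcond; apply: eq_integral => x _.
  rewrite patchE mem_setE in_itv/=; case: ifPn => // x01.
  by rewrite /arcsine_pdf (negbTE x01).
rewrite -UF.
have h1 : arcsine_prob (F n) @[n --> \oo] --> arcsine_prob (\bigcup_n F n).
  apply: ge0_nondecreasing_set_cvg_integral => //.
  - by move=> n; exact: measurable_itv.
  - move=> n; apply: measurable_funTS; apply: measurableT_comp => //.
    exact: measurable_arcsine_pdf.
  - by move=> n x _; rewrite lee_fin arcsine_pdf_ge0.
have h2 : arcsine_prob (F n) @[n --> \oo] --> 1%:E.
  under eq_fun do rewrite FE.
  apply: cvg_EFin; first by near=> n.
  rewrite -[X in _ --> X]subr0; apply: cvgB; first exact: cvg_cst.
  have := @cvg_harmonic R; rewrite -(cvg_shiftS (@harmonic R)).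
  exact.
exact: (cvg_unique _ h1 h2).
Unshelve. all: by end_near. Qed.

HB.instance Definition _ :=
  @Measure_isProbability.Build _ _ R arcsine_prob arcsine_setT.

End arcsine.
Arguments arcsine_prob R A : clear implicits.

(* The word model of the riffle shuffle: [true] stands for a card of the upper
   packet 1, ..., k, [false] for a card of the lower packet k+1, ..., n, where
   k is the number of occurrences of [true]. *)
Fixpoint interleave (i j : nat) (w : seq bool) : seq nat :=
  match w with
  | [::] => [::]
  | true :: w' => i :: interleave i.+1 j w'
  | false :: w' => j :: interleave i j.+1 w'
  end.

Definition deck (w : seq bool) : seq nat := interleave 1 (count id w).+1 w.

Section word_probability.
Context {R : realType} {n : nat}.

Lemma measurable_word (A : set (n.-tuple bool)) : measurable A.
Proof.
rewrite (_ : A = \bigcup_(w in A) [set w]); last first.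
  by apply/seteqP; split=> [w Aw|w [v Av ->//]]; exists w.
apply: fin_bigcup_measurable => [|w _]; first exact: finite_finset.
rewrite (_ : [set w] = \big[setI/setT]_(i < n)
    ((fun t : n.-tuple bool => tnth t i) @^-1` [set tnth w i])); last first.
  apply/seteqP; split=> [v -> /=|v /=].
    by rewrite -bigcap_seq => i _.
  rewrite -bigcap_seq => vw; apply/eq_from_tnth => i.
  by apply: vw; rewrite /= mem_index_enum.
apply: bigsetI_measurable => i _.
by rewrite -[X in measurable X]setTI; exact: measurable_tnth.
Qed.

Definition word_prob : set (n.-tuple bool) -> \bar R :=
  mscale ((2 ^- n)%:nng : {nonneg R}) counting.

HB.instance Definition _ := Measure.on word_prob.

Lemma word_probE (A : {pred n.-tuple bool}) :
  word_prob [set w | w \in A] = (#|A|%:R / 2 ^+ n)%:E.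
Proof.
rewrite /word_prob /mscale/= /counting asboolT; last exact: finite_finset.
rewrite -EFinM mulrC; congr (_%:R / _)%:E.
rewrite cardE -(size_map id) map_id.
apply: perm_size; apply: uniq_perm; rewrite ?fset_uniq ?enum_uniq// => w.
rewrite in_fset_set; last exact: finite_finset.
by rewrite mem_enum; apply/idP/idP; rewrite in_setE.
Qed.

Let word_probT : word_prob [set: _] = 1%:E.
Proof.
have -> : [set: n.-tuple bool] = [set w | w \in predT].
  by apply/seteqP; split.
by rewrite word_probE card_tuple card_bool natrX mulfV// expf_neq0.
Qed.

HB.instance Definition _ :=
  @Measure_isProbability.Build _ _ R word_prob word_probT.

End word_probability.
Arguments word_prob R n A : clear implicits.

Section guessing_game.
Variable n : nat.

(* A strategy maps the sequence of cards seen so far to the next guess. *)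
Definition strategy := seq nat -> nat.

(* Equivalently, guessing j for the j-th card has succeeded so far. *)
Definition first_phase (h : seq nat) : bool := h == iota 1 (size h).

(* In the second phase, the (1-based) position j of the first card that
   differs from its position, and the label m of this card. *)
Definition fail_pos (h : seq nat) : nat :=
  (find (fun i => nth 0%N h i != i.+1) (iota 0 (size h))).+1.
Definition fail_label (h : seq nat) : nat := nth 0%N h (fail_pos h).-1.

(* The cut is now known to be at m-1: what is left of j, ..., m-1 and of
   m+1, ..., n. *)
Definition lower_remaining (h : seq nat) : seq nat :=
  [seq c <- iota (fail_pos h) (fail_label h - fail_pos h) | c \notin h].
Definition upper_remaining (h : seq nat) : seq nat :=
  [seq c <- iota (fail_label h).+1 (n - fail_label h) | c \notin h].

Definition optimal_guess (h : seq nat) (c : nat) : bool :=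
  if first_phase h then c == (size h).+1
  else
    let s := lower_remaining h in
    let t := upper_remaining h in
    ((size t <= size s) && (c == head 0 s) ||
     (size s <= size t) && (c == head 0 t))%N.

(* The strategy is only constrained on the situations that can occur; either
   choice is allowed when the two remaining sequences have equal lengths. *)
Definition optimal_strategy (g : strategy) : Prop :=
  forall (w : n.-tuple bool) (i : nat), (i < n)%N ->
    optimal_guess (take i (deck w)) (g (take i (deck w))).

Context (R : realType) (g : strategy).

Definition success_prob (h : seq nat) : R :=
  cond_prob (word_prob R n)
    [set w | nth 0%N (deck w) (size h) = g h]
    [set w | take (size h) (deck w) = h].

Definition pure_luck (w : n.-tuple bool) (i : nat) : bool :=
  success_prob (take i (deck w)) == 2^-1.

(* [find] is n, hence the value is 0, if there is no pure luck guess. *)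
Definition first_pure_luck (w : n.-tuple bool) : R :=
  (n - find (pure_luck w) (iota 0 n))%:R / 2.

Definition normalized_luck (w : n.-tuple bool) : R :=
  first_pure_luck w / (n%:R / 2).

Lemma measurable_normalized_luck :
  measurable_fun [set: n.-tuple bool] normalized_luck.
Proof. by move=> _ Y _; exact: measurable_word. Qed.

HB.instance Definition _ := isMeasurableFun.Build _ _ _ _
  normalized_luck measurable_normalized_luck.

End guessing_game.
Arguments normalized_luck n R g w : clear implicits.

(* Main.v *)
(* Read the word from its last letter: the sum of the last l letters (a = 1,
   b = -1) is a simple random walk in l.  In the second phase the two remaining
   sequences have equal lengths exactly when this walk vanishes, so, unless the
   guesser is still in the first phase there, the first pure luck guess occurs
   at the last zero of the walk.  By the reflection principle the last zero is
   at 2k with probability u_k u_m (up to an exponentially small term), where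
   u_k = 'C(2k, k) / 4^k and m = (n - 2k)./2.  The Wallis bound
   u_k^2 >= 2 / (pi (2k + 1)) makes this at least 1 - O(1/n) times the increment
   of the arcsine distribution function over [2k/n, (2k+2)/n].  Summing over k
   bounds from below the probability of every interval ]a, b] with
   0 < a < b < 1; no upper bound is needed, since the arcsine law has total
   mass 1. *)

Require Import Defs.
From mathcomp Require Import all_boot all_order all_algebra.
From mathcomp Require Import all_classical all_reals all_analysis.
From mathcomp Require Import measurable_realfun ring lra zify.

Set Implicit Arguments.
Unset Strict Implicit.
Unset Printing Implicit Defensive.

Import Order.TTheory GRing.Theory Num.Theory.
Import numFieldNormedType.Exports.

(** * Counting words *)

Definition words (n : nat) (p : pred (seq bool)) : nat :=
  #|[pred w : n.-tuple bool | p w]|.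

Definition balanced (w : seq bool) : bool := count id w == count negb w.

Lemma wordsE n p : words n p = \sum_(w : n.-tuple bool) p w.
Proof.
by rewrite /words -sum1_card big_mkcond; apply: eq_bigr => w _; rewrite inE; case: (p w).
Qed.

Lemma eq_words n (p q : pred (seq bool)) :
  (forall w, size w = n -> p w = q w) -> words n p = words n q.
Proof. by move=> pq; apply: eq_card => w; rewrite !inE pq ?size_tuple. Qed.

Lemma leq_words n (p q : pred (seq bool)) :
  (forall w, size w = n -> p w -> q w) -> words n p <= words n q.
Proof.
move=> pq; apply/subset_leq_card/fintype.subsetP => w.
by rewrite !inE => /pq->//; rewrite size_tuple.
Qed.

Lemma words0 p : words 0 p = p [::].
Proof.
rewrite wordsE (big_pred1 [tuple]) // => w.
by rewrite /=; apply/esym/eqP; exact: tuple0.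
Qed.

Lemma wordsS n p :
  words n.+1 p = words n (fun w => p (true :: w)) + words n (fun w => p (false :: w)).
Proof.
rewrite !wordsE.
rewrite (reindex (fun bw : bool * n.-tuple bool => cons_tuple bw.1 bw.2)) /=; last first.
  exists (fun w => (thead w, [tuple of behead w])) => [[b w] _|w _] /=.
    by congr pair; apply: val_inj.
  by rewrite [RHS]tuple_eta; apply: val_inj.
rewrite -(pair_big xpredT xpredT (fun b (w : n.-tuple bool) => nat_of_bool (p (b :: w)))) /=.
by rewrite big_bool.
Qed.

Lemma words_map n p : words n (fun w => p (map negb w)) = words n p.
Proof.
elim: n p => [|n IH] p; first by rewrite !words0.
by rewrite !wordsS /= addnC (IH (fun w => p (true :: w))) (IH (fun w => p (false :: w))).
Qed.

Lemma words_rev n p : words n (fun w => p (rev w)) = words n p.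
Proof.
rewrite !wordsE (reindex (fun w : n.-tuple bool => [tuple of rev w])) /=.
  by apply: eq_bigr => w _; rewrite revK.
by exists (fun w : n.-tuple bool => [tuple of rev w]) => w _; apply: val_inj; rewrite /= revK.
Qed.

(** Lets an additive identity between counts be checked word by word, on indicators. *)
Lemma words_addn n (p1 p2 q1 q2 : pred (seq bool)) :
  (forall w, size w = n -> p1 w + p2 w = q1 w + q2 w) ->
  words n p1 + words n p2 = words n q1 + words n q2.
Proof.
move=> pq; rewrite !wordsE -!big_split /=; apply: eq_bigr => w _.
by rewrite pq ?size_tuple.
Qed.

Lemma words_false n : words n (fun=> false) = 0.
Proof. by rewrite wordsE big1. Qed.

(** Prefix and suffix of a uniform word are independent. *)
Lemma words_cat m n p q :
  words (m + n) (fun w => p (take m w) && q (drop m w)) = words m p * words n q.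
Proof.
elim: m p => [|m IH] p.
  rewrite words0 add0n; under eq_words do rewrite take0 drop0.
  by case: (p [::]); rewrite ?mul1n ?mul0n ?words_false.
by rewrite addSn !wordsS mulnDl -!IH.
Qed.

Lemma words_count n k : words n (fun w => count id w == k) = 'C(n, k).
Proof.
elim: n k => [|n IH] [|k]; rewrite ?words0 // wordsS /=.
  by rewrite words_false IH !bin0.
by rewrite binS addnC -!IH.
Qed.

Lemma words_all n : words n (all id) = 1.
Proof. by elim: n => [|n IH]; rewrite ?words0 // wordsS /= IH words_false. Qed.

Lemma count_negb_size w : count id w + count negb w = size w.
Proof. exact: (count_predC id w). Qed.

Lemma balancedE k w : size w = 2 * k -> balanced w = (count id w == k).
Proof. by have := count_negb_size w; rewrite /balanced; lia. Qed.

(** * Nonnegative walks and walks without return to zero *)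

Fixpoint stays (s : nat) (w : seq bool) : bool :=
  match w with
  | [::] => true
  | true :: w' => stays s.+1 w'
  | false :: w' => if s is s'.+1 then stays s' w' else false
  end.

Lemma stays_take s w i : stays s w ->
  count negb (take i w) <= count id (take i w) + s.
Proof.
elim: w s i => [|[] w IH] s [|i] //=.
  by move=> h; have := IH s.+1 i h; lia.
by case: s => // s h; have := IH s i h; lia.
Qed.

(* Reflection: the walks from [s] staying nonnegative are equinumerous to the
   walks whose displacement lies in [-s, s + 1]. *)
Lemma words_stays l s :
  words l (stays s) =
  words l (fun w => count negb w <= count id w + s <= count negb w + s + s.+1).
Proof.
elim: l s => [|l IH] s; first by rewrite !words0 /=; lia.
rewrite !wordsS /= !IH; case: s => [|s].
  (* At height 0 a step down is forbidden, and the band [[-1, 2]] for the displacement of the tail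
     splits into [[-1, 0]] (after a step up) and [[1, 2]] (after a step down). *)
  by apply: words_addn => w _ /=; lia.
(* The nested bands [[-s-2, s+3]] and [[-s, s+1]] cover every displacement as often as the
   overlapping bands [[-s-2, s+1]] and [[-s, s+3]]. *)
by rewrite IH; apply: words_addn => w _ /=; lia.
Qed.

(** For [s = 0] the band is [[0, 1]], and the parity of [l] leaves a single displacement in it. *)
Lemma words_stays0 l : words l (stays 0) = 'C(l, uphalf l).
Proof.
rewrite words_stays -words_count; apply: eq_words => w.
by have := count_negb_size w; lia.
Qed.

(** The indices stop before [size w], which exempts the empty suffix. Read from its last letter, the
    walk never returns to 0. *)
Definition no_balanced_suffix (w : seq bool) : bool :=
  all (fun i => ~~ balanced (drop i w)) (iota 0 (size w)).

(** After reversal suffixes become prefixes. A walk that steps up and then stays at or above its new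
    height never returns to 0; the mirror images of these walks account for the factor 2. *)
Lemma words_no_balanced_suffix m :
  2 * 'C(m, uphalf m) <= words m.+1 no_balanced_suffix.
Proof.
have nbs_rev w : (forall i, i < size w -> ~~ balanced (take i.+1 w)) ->
    no_balanced_suffix (rev w).
  move=> h; apply/allP => i; rewrite mem_iota size_rev add0n => /andP[_ iw].
  rewrite drop_rev /balanced !count_rev.
  by have := h (size w - i).-1; rewrite prednK ?subn_gt0 //; apply; lia.
rewrite -words_rev wordsS mul2n -addnn -words_stays0; apply: leq_add.
  apply: leq_words => w _ sw; apply: nbs_rev => i _.
  by have := stays_take i sw; rewrite /balanced /=; lia.
rewrite -words_map; apply: leq_words => w _ sw; apply: nbs_rev => i _.
have := stays_take i sw; rewrite -map_take !count_map /balanced /=.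
rewrite (@eq_count _ (preim negb negb) id); last by case.
rewrite (@eq_count _ (preim negb id) negb); last by case.
lia.
Qed.

(* [has negb] and the balanced suffix ensure that the first phase is over
   before the last [2 * k] cards. *)
Definition last_balanced (n k : nat) (w : seq bool) : bool :=
  (no_balanced_suffix (take (n - 2 * k) w) && has negb (take (n - 2 * k) w)) &&
  balanced (drop (n - 2 * k) w).

(** Prefix and suffix contribute independent factors; the condition [has negb] removes at most one
    prefix, the one made of [true] only, whence the [- 1]. *)
Lemma words_last_balanced n k : 2 * k < n ->
  'C(2 * k, k) * (2 * 'C((n - 2 * k).-1, uphalf (n - 2 * k).-1) - 1) <=
  words n (last_balanced n k).
Proof.
move=> kn.
rewrite [X in words X](_ : n = (n - 2 * k) + 2 * k); last by lia.
have -> : words (n - 2 * k + 2 * k) (last_balanced n k) =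
    words (n - 2 * k) (fun w => no_balanced_suffix w && has negb w) * words (2 * k) balanced.
  by rewrite -words_cat; apply: eq_words.
rewrite (eq_words (balancedE (k:=k))) words_count mulnC leq_mul2r; apply/orP; right.
rewrite leq_subLR -[X in X + _](words_all (n - 2 * k)).
set m := n - 2 * k; have m0 : 0 < m by rewrite /m; lia.
rewrite -(prednK m0) /=; apply: leq_trans (words_no_balanced_suffix _) _.
rewrite -[X in X <= _]add0n -(words_false m.-1.+1) addnC.
rewrite !wordsE -!big_split /=; apply: leq_sum => w _.
rewrite addn0 -(@eq_has _ (predC id)) // has_predC.
by case: no_balanced_suffix; case: all.
Qed.

(** * The guessing game *)

Lemma words_pred1 (x : seq bool) : words (size x) (pred1 x) = 1.
Proof.
elim: x => [|b x IH] /=; first by rewrite words0.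
rewrite wordsS -[RHS]IH -[RHS]addn0 -[X in _ = _ + X](words_false (size x)).
by case: b; [|rewrite addnC]; congr addn; apply: eq_words => w _ /=; rewrite eqseq_cons.
Qed.

Lemma words_notall n : words n (fun w => ~~ has id w) = 1.
Proof.
rewrite -(words_all n) -words_map; apply: eq_words => w _.
by rewrite -all_predC all_map; apply: eq_all; case.
Qed.

Lemma size_interleave p q w : size (interleave p q w) = size w.
Proof. by elim: w p q => //= -[] w IH p q /=; rewrite IH. Qed.

Lemma interleave_cat p q x y : interleave p q (x ++ y) =
  interleave p q x ++ interleave (p + count id x) (q + count negb x) y.
Proof.
elim: x p q => [|[] x IH] p q /=; first by rewrite !addn0.
  by rewrite IH add0n addSnnS add1n.
by rewrite IH add0n addSnnS add1n.
Qed.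

Lemma take_interleave i p q w : take i (interleave p q w) = interleave p q (take i w).
Proof. by elim: w i p q => [|[] w IH] [|i] p q //=; rewrite IH. Qed.

Lemma interleave_iota p q w : all id w -> interleave p q w = iota p (size w).
Proof. by elim: w p => [|[] w IH] p //= /IH->. Qed.

Lemma interleave_iota_false p q w : ~~ has id w -> interleave p q w = iota q (size w).
Proof. by elim: w q => [|[] w IH] q //= /IH->. Qed.

Lemma mem_interleave c p q w : (c \in interleave p q w) =
  (p <= c < p + count id w) || (q <= c < q + count negb w).
Proof.
elim: w p q => [|[] w IH] p q /=; first by rewrite in_nil; lia.
  by rewrite inE IH; lia.
by rewrite inE IH; lia.
Qed.

Lemma size_deck w : size (deck w) = size w.
Proof. exact: size_interleave. Qed.

Lemma take_deck i w : take i (deck w) = interleave 1 (count id w).+1 (take i w).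
Proof. exact: take_interleave. Qed.

Lemma nth_deck i w : i < size w -> nth 0 (deck w) i =
  if nth false w i then 1 + count id (take i w)
  else (count id w).+1 + count negb (take i w).
Proof.
move=> iw; rewrite /deck -{2}(cat_take_drop i w) interleave_cat.
rewrite nth_cat size_interleave size_takel ?(ltnW iw) // ltnn subnn.
by rewrite (drop_nth false iw); case: (nth false w i).
Qed.

(** The first [false] puts card [k.+1] where [a.+1] is expected, a visible mismatch because [a < k];
    its label reveals the cut. *)
Lemma fail_interleave k a z : a < k ->
  let h := interleave 1 k.+1 (nseq a true ++ false :: z) in
  [/\ ~~ first_phase h, fail_pos h = a.+1 & fail_label h = k.+1].
Proof.
move=> ak h.
have hE : h = iota 1 a ++ k.+1 :: interleave a.+1 k.+2 z.
  rewrite /h interleave_cat /= interleave_iota ?all_nseq ?orbT // size_nseq.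
  by rewrite !count_nseq mul1n mul0n addn0 add1n.
have nth_a : nth 0 h a = k.+1 by rewrite hE nth_cat size_iota ltnn subnn.
have nth_lt i : i < a -> nth 0 h i = i.+1.
  by move=> ia; rewrite hE nth_cat size_iota ia nth_iota // add1n.
have sh : size h = a + (size z).+1 by rewrite hE size_cat size_iota /= size_interleave.
have fE : fail_pos h = a.+1.
  rewrite /fail_pos sh iotaD find_cat add0n.
  case: hasP => [[i]|_].
    by rewrite mem_iota add0n => /nth_lt->; rewrite eqxx.
  by rewrite /= nth_a size_iota eqSS gtn_eqF //= addn0.
split=> //; last by rewrite /fail_label fE.
apply/negP => /eqP /(congr1 (nth 0 ^~ a)); rewrite nth_a nth_iota ?sh; last by lia.
lia.
Qed.

Lemma has_negb_split x : has negb x ->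
  exists a z, x = nseq a true ++ false :: z.
Proof.
move=> hx; pose a := find negb x; exists a, (drop a.+1 x).
rewrite -[LHS](cat_take_drop a); congr cat.
  apply: (@eq_from_nth _ true).
    by rewrite size_nseq size_takel // find_size.
  move=> i; rewrite size_takel ?find_size // => ia.
  rewrite nth_take // nth_nseq ia.
  by have := before_find true ia => /negbFE.
rewrite (drop_nth true) -?has_find //; congr cons.
exact/negbTE/(nth_find true).
Qed.

(** Converse of [fail_interleave]: if the first [false] comes only after all [k] letters [true],
    then only [false] follows and the cards appear in natural order. *)
Lemma second_phase_split k x : count id x <= k ->
  ~~ first_phase (interleave 1 k.+1 x) ->
  exists a z, x = nseq a true ++ false :: z /\ a < k.
Proof.
move=> xk; case: (boolP (has negb x)) => [|/hasPn hx]; last first.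
  rewrite /first_phase interleave_iota ?size_iota ?eqxx //.
  by apply/allP => b /hx; rewrite negbK.
move=> /has_negb_split[a [z xE]] h; exists a, z.
split=> //; rewrite ltnNge; apply/negP => ka; case/negP: h.
move: xk; rewrite xE count_cat count_nseq mul1n /= add0n => xk.
have ak : a = k by lia.
have hz : ~~ has id z by rewrite has_count; lia.
rewrite interleave_cat interleave_iota ?all_nseq ?orbT // count_nseq mul1n.
rewrite /first_phase (@interleave_iota_false _ _ (_ :: _)) ?count_nseq ?mul0n ?addn0 //.
by rewrite size_cat !size_iota iotaD size_nseq -ak add1n.
Qed.

Lemma filter_iota_suffix (P : pred nat) p u v :
  (forall c, p <= c < p + u -> ~~ P c) ->
  (forall c, p + u <= c < p + u + v -> P c) ->
  [seq c <- iota p (u + v) | P c] = iota (p + u) v.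
Proof.
move=> hu hv; rewrite iotaD filter_cat (eq_in_filter (a2 := pred0)); last first.
  by move=> c; rewrite mem_iota => /hu /negbTE.
rewrite filter_pred0 /= (eq_in_filter (a2 := predT)) ?filter_predT //.
by move=> c; rewrite mem_iota => /hv.
Qed.

(** Translates the view of the guesser into letters: the lengths of the two remaining sequences are
    the letter counts of the unread suffix. *)
Lemma remaining_interleave n (w : n.-tuple bool) i : i < n ->
  let x := take i w in let y := drop i w in let h := take i (deck w) in
  ~~ first_phase h ->
  lower_remaining h = iota (1 + count id x) (count id y) /\
  upper_remaining n h = iota ((count id w).+1 + count negb x) (count negb y).
Proof.
move=> ilt x y h hh; set k := count id w.
have kE : k = count id x + count id y by rewrite -count_cat cat_take_drop.
have nE : n = k + (count negb x + count negb y).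
  by rewrite -count_cat cat_take_drop count_negb_size size_tuple.
have hE : h = interleave 1 k.+1 x by rewrite /h take_deck.
have [a [z [xE ak]]] : exists a z, x = nseq a true ++ false :: z /\ a < k.
  by apply: second_phase_split; rewrite -?hE //; lia.
have [_ posE labE] := fail_interleave z ak.
rewrite -xE -hE in posE labE.
have xa : a <= count id x by rewrite xE count_cat count_nseq mul1n leq_addr.
have xf : 0 < count negb x by rewrite xE count_cat /=; lia.
rewrite /lower_remaining /upper_remaining posE labE; split.
  rewrite (_ : k.+1 - a.+1 = (count id x - a) + count id y); last by lia.
  rewrite (_ : 1 + count id x = a.+1 + (count id x - a)); last by lia.
  by apply: filter_iota_suffix => c; rewrite hE mem_interleave; lia.
(* The failing card [k.+1] was itself dealt from the lower packet but lies outside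
   [upper_remaining], hence the predecessor. *)
rewrite (_ : n - k.+1 = (count negb x).-1 + count negb y); last by lia.
rewrite (_ : k.+1 + count negb x = k.+2 + (count negb x).-1); last by lia.
by apply: filter_iota_suffix => c; rewrite hE mem_interleave; lia.
Qed.

(** In the second phase the history carries exactly the letters read and the cut: the failing label
    gives the cut, and comparison with the cut decodes each card. *)
Lemma deck_second_phaseE n (w w' : n.-tuple bool) i : i < n ->
  ~~ first_phase (take i (deck w)) ->
  (take i (deck w') == take i (deck w)) =
  (take i w' == take i w) && (count id w' == count id w).
Proof.
move=> ilt hw; apply/eqP/andP => [e|[/eqP e1 /eqP e2]]; last first.
  by rewrite !take_deck e1 e2.
have le_count (v : seq bool) : count id (take i v) <= count id v.
  by rewrite -{2}(cat_take_drop i v) count_cat leq_addr.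
have lab (v : n.-tuple bool) : ~~ first_phase (take i (deck v)) ->
    fail_label (take i (deck v)) = (count id v).+1.
  rewrite take_deck => /(second_phase_split (le_count v))[a [z [-> ak]]].
  by have [] := fail_interleave z ak.
have hw' : ~~ first_phase (take i (deck w')) by rewrite e.
have ek : count id w' = count id w.
  by apply: succn_inj; rewrite -lab // -[RHS]lab // e.
(* A card comes from the upper packet iff its label is at most the cut. *)
have decode (v : seq bool) p q k : p + count id v <= k.+1 <= q ->
    [seq c <= k | c <- interleave p q v] = v.
  elim: v p q => [|[] v IH] p q //= h; rewrite IH ?andbT; try lia.
    by congr cons; lia.
  by congr cons; lia.
split; last exact/eqP.
have h1 : take i w' = [seq c <= count id w | c <- take i (deck w')].
  by rewrite take_deck decode //; have := le_count w'; lia.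
by rewrite h1 e take_deck decode //; have := le_count w; lia.
Qed.

(** * Pure luck guesses as identities between counts *)

Lemma word_prob_words (R : realType) n (A : set (n.-tuple bool)) (p : pred (seq bool)) :
  (forall w : n.-tuple bool, A w <-> p w) ->
  word_prob R n A = ((words n p)%:R / 2 ^+ n)%:E%R.
Proof.
move=> Ap; rewrite /words -word_probE; congr (word_prob R n _).
by apply/seteqP; split => w; rewrite /= inE /= => /Ap.
Qed.

Lemma pure_luck_words (R : realType) n (g : strategy) (w : n.-tuple bool) i :
  i < n -> let h := take i (deck w) in
  pure_luck R g w i =
  (2 * words n (fun w' => (take i (deck w') == h) && (nth 0%N (deck w') i == g h))
   == words n (fun w' => take i (deck w') == h)).
Proof.
move=> ilt h; have sh : size h = i by rewrite size_takel // size_deck size_tuple ltnW.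
rewrite /pure_luck /success_prob /cond_prob sh -/h.
set PA := fine _; set PB := fine _.
have -> : PA = fine ((words n (fun w' => (take i (deck w') == h) &&
    (nth 0%N (deck w') i == g h)))%:R / 2 ^+ n)%:E%R.
  congr fine; apply: word_prob_words => w'.
  by split=> [[/= -> ->]|/andP[/eqP ? /eqP ?]]; rewrite ?eqxx.
have -> : PB = fine ((words n (fun w' => take i (deck w') == h))%:R / 2 ^+ n)%:E%R.
  congr fine; apply: word_prob_words => w'.
  by split=> /= /eqP.
rewrite {PA PB}.
(* The word [w] has its own history, so the conditioning event is not null and [cond_prob] is a
   genuine quotient. *)
have : 0 < words n (fun w' => take i (deck w') == h).
  rewrite /words; apply/card_gt0P; exists w; rewrite inE /=; exact/eqP.
set b := words n (fun w' => take i (deck w') == h) => b0; set c := words n _.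
move: b c b0 => b c b0 /=.
have b0' : (b%:R != 0 :> R)%R by rewrite pnatr_eq0 -lt0n.
rewrite -[RHS](eqr_nat R) natrM; apply/eqP/eqP => e.
  have : (c%:R / b%:R = 2^-1 :> R)%R.
    by rewrite -e; field; rewrite b0' expf_neq0.
  move=> {}e; have -> : (c%:R = c%:R / b%:R * b%:R :> R)%R by field.
  by rewrite e; field.
have c0 : (c%:R != 0 :> R)%R by move: b0'; rewrite -e mulf_eq0 pnatr_eq0.
by rewrite -e; field; rewrite c0 expf_neq0.
Qed.

(** With [m] letters after the next one, at least [2 ^ m + 1] words compatible with the history make
    the guess correct and at most [2 ^ m] make it wrong. *)
Lemma first_phase_not_luck (R : realType) n (g : strategy) (w : n.-tuple bool) i :
  optimal_strategy n g -> i < n -> first_phase (take i (deck w)) ->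
  ~~ pure_luck R g w i.
Proof.
move=> hg ilt hw; rewrite pure_luck_words //.
have sh : size (take i (deck w)) = i by rewrite size_takel // size_deck size_tuple ltnW.
have -> : g (take i (deck w)) = i.+1.
  by have := hg w i ilt; rewrite /optimal_guess hw sh => /eqP.
move: hw; rewrite /first_phase sh => /eqP ->.
pose m := (n - i).-1; have nE : n = i + m.+1 by rewrite /m; lia.
pose A (w : seq bool) := (take i (deck w) == iota 1 i) && (nth 0%N (deck w) i == i.+1).
pose B (w : seq bool) := (take i (deck w) == iota 1 i) && (nth 0%N (deck w) i != i.+1).
have BE : words n (fun w' => take i (deck w') == iota 1 i) = words n A + words n B.
  rewrite -[LHS]addn0 -[X in _ + X = _](words_false n); apply: words_addn => v _.
  by rewrite /A /B; case: (_ == iota 1 i); case: (nth _ _ _ == i.+1).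
(* A wrong guess requires [i] letters [true], then [false], with some [true] still to come. *)
have leB : words n B <= words m (has id).
  pose q (v : seq bool) := if v is false :: v' then has id v' else false.
  have <- : words m.+1 q = words m (has id) by rewrite wordsS /q words_false.
  rewrite -[X in _ <= X]mul1n -(words_all i) -words_cat -nE.
  apply: leq_words => v sv /andP[hv hn].
  have fp : first_phase (take i (deck v)) by rewrite /first_phase (eqP hv) size_iota.
  have kE : count id v = count id (take i v) + count id (drop i v).
    by rewrite -count_cat cat_take_drop.
  have sx : size (take i v) = i by rewrite size_takel // sv ltnW.
  have := count_negb_size (take i v); rewrite sx => iE.
  have letter := drop_nth false (_ : i < size v); rewrite sv in letter.
  move: hn; rewrite nth_deck ?sv // letter // in kE *.
  move: (nth false v i) (drop i.+1 v) kE => b r kE.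
  case: (boolP (all id (take i v))) => hx /=.
    have : count negb (take i v) == 0.
      by rewrite -leqn0 leqNgt -has_count -all_predC; apply: sub_all hx => -[].
    by case: b kE => /= kE; rewrite /q ?has_count; lia.
  (* A [false] was read without a mismatch, so the upper packet is exhausted and the guess cannot
     fail. *)
  have [a [z xE]] : exists a z, take i v = nseq a true ++ false :: z.
    by apply: has_negb_split; rewrite -has_predC in hx.
  have ka : count id v <= a.
    rewrite leqNgt; apply/negP => ak; have [] := fail_interleave z ak.
    by rewrite -xE -take_deck fp.
  have : count id (take i v) = a + count id z by rewrite xE count_cat count_nseq mul1n.
  by case: b kE => /= kE; lia.
(* After [i] letters [true] the guess succeeds on any next [true], and also on a [false] followed by
   no [true]; the latter is the one extra word that makes the inequality strict. *)
have leA : words m predT + words m (fun v => ~~ has id v) <= words n A.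
  pose q (v : seq bool) := if v is false :: v' then ~~ has id v' else v != [::].
  have <- : words m.+1 q = words m predT + words m (fun v => ~~ has id v).
    by rewrite wordsS /q; congr addn; apply: eq_words => v _ /=; case: (has id v).
  rewrite -[X in X <= _]mul1n -(words_all i) -words_cat -nE.
  apply: leq_words => v sv /andP[hv hn].
  have kE : count id v = count id (take i v) + count id (drop i v).
    by rewrite -count_cat cat_take_drop.
  have sx : size (take i v) = i by rewrite size_takel // sv ltnW.
  have := count_negb_size (take i v); rewrite sx => iE.
  have : count negb (take i v) == 0.
    by rewrite -leqn0 leqNgt -has_count -all_predC; apply: sub_all hv => -[].
  move=> c0; rewrite /A take_deck interleave_iota // sx eqxx /= nth_deck ?sv //.
  have letter := drop_nth false (_ : i < size v); rewrite sv in letter.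
  move: hn kE; rewrite letter //; case: nth => /=; first by lia.
  by rewrite has_count; lia.
have lt_m : words m (has id) <= words m predT by exact: leq_words.
rewrite words_notall in leA; rewrite BE -/(words n A).
change (2 * words n A != words n A + words n B).
lia.
Qed.

Lemma words_take_pred1 n (x : seq bool) (q : pred (seq bool)) : size x <= n ->
  words n (fun w => (take (size x) w == x) && q (drop (size x) w)) =
  words (n - size x) q.
Proof.
move=> xn; rewrite -[RHS]mul1n -(words_pred1 x) -words_cat subnKC //.
Qed.

(** The ratio of the two binomials is [s / (m + 1)], the chance that the next letter is [true] when
    [s] of the [m + 1] letters left are [true]. The next lemma treats [false] in the same way. *)
Lemma bin_half_lower m s : 0 < s -> s <= m.+1 ->
  (2 * 'C(m, s.-1) == 'C(m.+1, s)) = (2 * s == m.+1).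
Proof.
move=> s0 sm; have := mul_bin_diag m.+1 s.-1; rewrite prednK //= => e.
have b0 : 0 < 'C(m.+1, s) by rewrite bin_gt0.
rewrite -(eqn_pmul2l (ltn0Sn m)) mulnCA e -[RHS](eqn_pmul2r b0).
by rewrite mulnA.
Qed.

Lemma bin_half_upper m s : s <= m.+1 ->
  (2 * 'C(m, s) == 'C(m.+1, s)) = (2 * (m.+1 - s) == m.+1).
Proof.
move=> sm; have := mul_bin_down m.+1 s => /= e.
have b0 : 0 < 'C(m.+1, s) by rewrite bin_gt0.
rewrite -(eqn_pmul2l (ltn0Sn m)) mulnCA e -[RHS](eqn_pmul2r b0).
by rewrite mulnA.
Qed.

(** Given the history, the unread suffix is uniform among the words with [s] letters [true] and [t]
    letters [false], so either guess has probability one half exactly when [s = t]. *)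
Lemma second_phase_luck (R : realType) n (g : strategy) (w : n.-tuple bool) i :
  optimal_strategy n g -> i < n -> ~~ first_phase (take i (deck w)) ->
  pure_luck R g w i = balanced (drop i w).
Proof.
move=> hg ilt hw; rewrite pure_luck_words //.
set x := take i w; set s := count id (drop i w); set t := count negb (drop i w).
have sx : size x = i by rewrite size_takel // size_tuple ltnW.
pose m := (n - i).-1; have nE : n = i + m.+1 by rewrite /m; lia.
have stE : s + t = m.+1 by rewrite count_negb_size size_drop size_tuple nE addKn.
have kE : count id w = count id x + s by rewrite -count_cat cat_take_drop.
have [loE upE] := remaining_interleave ilt hw.
(* A [false] has been read; this keeps the two candidate labels distinct, even when no [true] is
   left. *)
have xf : 0 < count negb x.
  have [||a [z [xE _]]] := @second_phase_split (count id w) x.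
  - by rewrite kE leq_addr.
  - by rewrite -take_deck.
  - by rewrite xE count_cat /=; lia.
have [d gE hd] : exists2 d, g (take i (deck w)) =
    (if d then 1 + count id x else (count id w).+1 + count negb x) &
    if d then t <= s else s <= t.
  have := hg w i ilt; rewrite /optimal_guess (negbTE hw) loE upE !size_iota.
  case/orP => /andP[st /eqP ->]; [exists true => //|exists false => //].
    (* The longer sequence is nonempty as [s + t = m.+1], so [head 0] does not return its
       default. *)
    by move: st; rewrite -/s -/t; case: (s) stE => //=; lia.
  by move: st; rewrite -/s -/t; case: (t) stE => //=; lia.
have BE v : size v = n -> (take i (deck v) == take i (deck w)) =
    (take (size x) v == x) && (count id (drop (size x) v) == s).
  move=> sv; have /= -> := @deck_second_phaseE _ w (Tuple (introT eqP sv)) i ilt hw.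
  rewrite sx -/x; case: eqP => //= e.
  by rewrite -{1}(cat_take_drop i v) count_cat e kE eqn_add2l.
have -> : words n (fun v => take i (deck v) == take i (deck w)) = 'C(m.+1, s).
  rewrite (eq_words BE) (@words_take_pred1 n x (fun v => count id v == s)) ?sx ?(ltnW ilt) //.
  by rewrite words_count; congr 'C(_, _); lia.
have -> : words n (fun v => (take i (deck v) == take i (deck w)) &&
     (nth 0 (deck v) i == g (take i (deck w)))) =
    words m.+1 (fun v => (head false v == d) && (count id v == s)).
  pose q (v : seq bool) := (head false v == d) && (count id v == s).
  rewrite (_ : m.+1 = n - size x); last by lia.
  rewrite -[RHS](@words_take_pred1 n x q) ?sx ?(ltnW ilt) //.
  apply: eq_words => v sv; rewrite BE // sx /q.
  case: eqP => //= e; case: (boolP (_ == s)) => //= es; rewrite ?andbF // andbT.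
  have hv : count id v = count id w.
    by rewrite -(cat_take_drop i v) count_cat e (eqP es) kE.
  rewrite nth_deck ?sv // e hv gE (drop_nth false) ?sv //=.
  by case: (nth _ _ _); case: (d); rewrite ?eqxx //; lia.
rewrite wordsS /balanced -/s -/t; case: d gE hd => /= gE hd.
  rewrite words_false addn0.
  have s0 : 0 < s by lia.
  rewrite (@eq_words _ _ (fun v => count id v == s.-1)); last by move=> v _; lia.
  by rewrite words_count bin_half_lower; lia.
rewrite words_false add0n (@eq_words _ _ (fun v => count id v == s));
  last by move=> v _; lia.
by rewrite words_count bin_half_upper; lia.
Qed.

Lemma find_iota (P : pred nat) n i : i < n -> P i -> (forall j, j < i -> ~~ P j) ->
  find P (iota 0 n) = i.
Proof.
move=> ilt Pi Pj; rewrite -(subnKC ilt) addSnnS iotaD find_cat add0n size_iota /= Pi addn0.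
by case: hasP => // -[j]; rewrite mem_iota => /Pj/negbTE->.
Qed.

(** The guess before the last [2 * k] cards is pure luck, and no earlier one is: not in the first
    phase, and not in the second phase because the prefix has no balanced suffix. *)
Lemma normalized_luck_last_balanced (R : realType) n k (g : strategy) (w : n.-tuple bool) :
  optimal_strategy n g -> 0 < k -> 2 * k < n -> last_balanced n k w ->
  normalized_luck n R g w = ((2 * k)%:R / n%:R)%R.
Proof.
move=> hg k0 kn /andP[/andP[/allP hs hf] hb].
have ilt : n - 2 * k < n by lia.
have sx : size (take (n - 2 * k) w) = n - 2 * k.
  by rewrite size_takel // size_tuple ltnW.
have nE : (n%:R != 0 :> R)%R by rewrite pnatr_eq0; lia.
rewrite /normalized_luck /first_pure_luck (@find_iota _ _ (n - 2 * k)) //.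
- by rewrite subKn ?(ltnW kn) //; field.
- rewrite second_phase_luck //.
  have [a [z xE]] := has_negb_split hf.
  (* As [0 < k], the balanced suffix contains a [true], so the first [false] comes before the upper
     packet is exhausted. *)
  rewrite take_deck xE; have ak : a < count id w.
    rewrite -(cat_take_drop (n - 2 * k) w) count_cat xE count_cat count_nseq mul1n.
    have := count_negb_size (drop (n - 2 * k) w); rewrite size_drop size_tuple.
    by move: hb; rewrite /balanced; lia.
  by have [] := fail_interleave z ak.
- move=> j jlt; have jn : j < n by lia.
  case: (boolP (first_phase (take j (deck w)))) => hj.
    exact: first_phase_not_luck.
  rewrite second_phase_luck // -(cat_take_drop (n - 2 * k) w) drop_cat sx jlt.
  (* Removing the balanced last [2 * k] letters from a balanced suffix would leave a balanced suffix
     of the prefix. *)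
  have : j \in iota 0 (size (take (n - 2 * k) w)) by rewrite mem_iota sx add0n.
  move=> /hs; move: hb; rewrite /balanced !count_cat => /eqP->.
  by rewrite eqn_add2r.
Qed.

Local Open Scope ring_scope.
Local Open Scope classical_set_scope.

(** * Convergence to the arcsine law *)

Section wallis.
Context {R : realType}.
Implicit Types (x : R) (n k : nat).

(** The reduction formula for the integral of [sin ^+ n] from 0 to [x], taken as a definition, so
    that only derivatives have to be computed. *)
Fixpoint sin_primitive n x : R :=
  match n with
  | 0 => x
  | 1 => 1 - cos x
  | n'.+2 => (n'.+1%:R * sin_primitive n' x - sin x ^+ n'.+1 * cos x) / n'.+2%:R
  end.

Lemma sin_primitiveSS n x : sin_primitive n.+2 x =
  (n.+1%:R * sin_primitive n x - sin x ^+ n.+1 * cos x) / n.+2%:R.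
Proof. by []. Qed.

Lemma is_derive_sin_primitive n x :
  is_derive x 1 (sin_primitive n) (sin x ^+ n).
Proof.
elim/ltn_ind: n x => -[|[|n]] IH x.
- by rewrite expr0 /=; exact: is_derive_id.
- rewrite expr1 /=; by apply: is_derive_eq; rewrite add0r opprK mul1r.
- have h := IH n (ltnW (ltnSn _)) x.
  have hX : is_derive x 1 (fun y : R => sin y ^+ n.+1) (n.+1%:R * sin x ^+ n * cos x).
    rewrite (_ : (fun y => _) = sin ^+ n.+1); last by apply/funext => y; rewrite exprfctE.
    by apply: is_derive_eq; rewrite /GRing.scale/=; ring.
  apply: is_derive_eq.
  rewrite /GRing.scale/=.
  have n2 : n.+2%:R != 0 :> R by rewrite pnatr_eq0.
  have cs : cos x ^+ 2 = 1 - sin x ^+ 2 by rewrite -(cos2Dsin2 x) addrK.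
  rewrite mulr0 mulr0 add0r.
  have -> : n.+1%:R * sin x ^+ n -
      (sin x ^+ n.+1 * - sin x + cos x * (n.+1%:R * sin x ^+ n * cos x)) =
      n.+1%:R * sin x ^+ n * (1 - cos x ^+ 2) + sin x ^+ n * sin x ^+ 2.
    by rewrite !exprS expr0; ring.
  by rewrite cs -[n.+2%:R]natr1 !exprS expr0; field; rewrite nat1r natr1.
Qed.

Lemma sin_primitive_at0 n : sin_primitive n 0 = 0.
Proof.
elim/ltn_ind: n => -[|[|n]] IH //=; first by rewrite cos0 subrr.
by rewrite IH // sin0 expr0n /= mulr0 mul0r subrr mul0r.
Qed.

Definition central_bin k : R := 'C(2 * k, k)%:R / 4 ^+ k.

Lemma central_bin_gt0 k : 0 < central_bin k.
Proof. by rewrite divr_gt0 ?exprn_gt0 // ltr0n bin_gt0; lia. Qed.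

Lemma central_binS k :
  central_bin k.+1 = (2 * k).+1%:R / (2 * k).+2%:R * central_bin k.
Proof.
have h : (k.+1 * 'C(2 * k.+1, k.+1) = 2 * (2 * k).+1 * 'C(2 * k, k))%N.
  have e1 := mul_bin_diag (2 * k).+2 k; have e2 := mul_bin_diag (2 * k).+1 k.
  have e3 : ('C((2 * k).+1, k) = 'C((2 * k).+1, k.+1))%N.
    by rewrite -bin_sub; [congr ('C(_, _))|]; lia.
  rewrite /= in e1 e2; rewrite (_ : 2 * k.+1 = (2 * k).+2)%N; last by lia.
  by rewrite -e1 e3; nia.
have {}h : k.+1%:R * 'C(2 * k.+1, k.+1)%:R = 2 * (2 * k).+1%:R * 'C(2 * k, k)%:R :> R.
  by rewrite -!natrM h.
rewrite /central_bin exprS.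
apply: (mulfI (_ : k.+1%:R != 0 :> R)); first by rewrite pnatr_eq0.
rewrite [LHS]mulrA h (_ : (2 * k).+2%:R = 2 * k.+1%:R :> R);
  last by rewrite -natrM; congr _%:R; lia.
by field; rewrite expf_neq0 //= nat1r pnatr_eq0.
Qed.

Lemma sin_primitive_even k : sin_primitive (2 * k) (pi / 2) = pi / 2 * central_bin k.
Proof.
elim: k => [|k IH]; first by rewrite /central_bin muln0 bin0 expr0 divr1 mulr1.
rewrite central_binS mulrCA -IH (_ : 2 * k.+1 = (2 * k).+2)%N; last by lia.
by rewrite sin_primitiveSS cos_pihalf mulr0 subr0; ring.
Qed.

Lemma sin_primitive_odd k :
  sin_primitive (2 * k).+1 (pi / 2) * ((2 * k).+1%:R * central_bin k) = 1.
Proof.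
elim: k => [|k IH].
  by rewrite muln0 /= cos_pihalf /central_bin muln0 bin0 expr0 divr1 subr0 !mul1r.
rewrite central_binS (_ : 2 * k.+1 = (2 * k).+2)%N; last by lia.
rewrite -[RHS]IH.
have -> : sin_primitive (2 * k).+3 (pi / 2) =
    (2 * k).+2%:R * sin_primitive (2 * k).+1 (pi / 2) / (2 * k).+3%:R.
  by rewrite sin_primitiveSS cos_pihalf mulr0 subr0.
have : (2 * k).+2%:R != 0 :> R by rewrite pnatr_eq0.
have : (2 * k).+3%:R != 0 :> R by rewrite pnatr_eq0.
move: ((2 * k).+3%:R) ((2 * k).+2%:R) => a b a0 b0.
by field; rewrite a0 b0.
Qed.

(** Both primitives vanish at 0, and [sin x ^+ n.+1 <= sin x ^+ n] on [[0, pi / 2]]; the mean value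
    theorem applies to the difference. *)
Lemma sin_primitive_le n : sin_primitive n.+1 (pi / 2) <= sin_primitive n (pi / 2).
Proof.
have pi2 : 0 < pi / 2 :> R by rewrite divr_gt0 ?pi_gt0.
pose f := sin_primitive n - sin_primitive n.+1.
have df (x : R) : is_derive x 1 f (sin x ^+ n - sin x ^+ n.+1).
  by apply: is_deriveB; exact: is_derive_sin_primitive.
have cf : {within `[0, pi / 2], continuous f}.
  by apply: derivable_within_continuous => x _; apply: ex_derive.
have [c c_in] := MVT pi2 (fun x _ => df x) cf.
rewrite /f !fctE !sin_primitive_at0 !subr0 => e.
rewrite -subr_ge0 e mulr_ge0 ?(ltW pi2) // exprS -[X in X - _]mul1r -mulrBl.
rewrite mulr_ge0 ?subr_ge0 ?sin_le1 // exprn_ge0 // ?ltW ?sin_gt0_pihalf //.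
Qed.

(** Comparing the integrals of orders [2 * k] and [(2 * k).+1] gives
    [1 / ((2k + 1) u) <= pi / 2 * u] with [u = central_bin k]. *)
Lemma central_bin_lower k : 2 / (pi * (2 * k).+1%:R) <= central_bin k ^+ 2.
Proof.
have p0 : 0 < pi :> R := pi_gt0 R.
have := sin_primitive_le (2 * k); rewrite sin_primitive_even.
have d0 : 0 < (2 * k).+1%:R * central_bin k by rewrite mulr_gt0 ?central_bin_gt0.
rewrite -(ler_pM2r d0) sin_primitive_odd => h.
rewrite ler_pdivrMr ?mulr_gt0 //.
have -> : central_bin k ^+ 2 * (pi * (2 * k).+1%:R) =
    2 * (pi / 2 * central_bin k * ((2 * k).+1%:R * central_bin k)) by field.
by lra.
Qed.
End wallis.

(** * Analytic lower bound for the probability of [last_balanced] *)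

Section luck_lower_bound.
Context {R : realType}.

Lemma central_bin_le1 k : central_bin k <= 1 :> R.
Proof.
rewrite /central_bin ler_pdivrMr ?exprn_gt0 // mul1r -natrX ler_nat.
rewrite -[4%N]/(2 ^ 2)%N -expnM -words_count /words.
by apply: leq_trans (max_card _) _; rewrite card_tuple card_bool.
Qed.

(** Turns the bound of [words_no_balanced_suffix] into a return probability. For even [m] two equal
    neighbouring binomials add up to the central one; for odd [m] the factor 2 cancels. *)
Lemma half_central_bin m : (0 < m)%N ->
  2 * 'C(m.-1, uphalf m.-1)%:R / 2 ^+ m = central_bin m./2 :> R.
Proof.
have four : 4 = 2 ^+ 2 :> R by ring.
move=> m0; rewrite /central_bin four -exprM; set p := m./2.
have [mE|mE] : m = (2 * p)%N \/ m = (2 * p).+1.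
- by have := odd_double_half m; case: odd; rewrite -/p; lia.
- have [q pE] : exists q, p = q.+1 by exists p.-1; lia.
  rewrite {1 3}mE {}mE pE (_ : 2 * q.+1 = (2 * q).+2)%N; last by lia.
  rewrite (_ : uphalf (2 * q).+2.-1 = q.+1); last by lia.
  rewrite /= (binS (2 * q).+1 q) natrD.
  have -> : ('C((2 * q).+1, q) = 'C((2 * q).+1, q.+1))%N.
    by rewrite -bin_sub; [congr ('C(_, _))|]; lia.
  by rewrite -mulr2n mulr_natl.
- rewrite {}mE /= (_ : uphalf (2 * p) = p); last by lia.
  by rewrite exprS; field; rewrite expf_neq0.
Qed.

Lemma words_last_balanced_lower n k : (0 < k)%N -> (2 * k < n)%N ->
  2 / (pi * Num.sqrt ((2 * k).+1%:R * (n - 2 * k).+1%:R)) - 4 / (n - 2 * k)%:R ^+ 2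
  <= (words n (last_balanced n k))%:R / 2 ^+ n :> R.
Proof.
move=> k0 kn; set m := (n - 2 * k)%N; have m0 : (0 < m)%N by rewrite /m; lia.
have p0 : 0 < pi :> R := pi_gt0 R.
set u : R := central_bin k; set v : R := central_bin m./2.
have u0 : 0 < u := central_bin_gt0 k.
have v0 : 0 < v := central_bin_gt0 _.
have uv : 2 / (pi * Num.sqrt ((2 * k).+1%:R * m.+1%:R)) <= u * v.
  rewrite -(@ler_pXn2r _ 2) ?nnegrE //; last 2 first.
  - by rewrite divr_ge0 // mulr_ge0 ?sqrtr_ge0 ?ltW.
  - by rewrite mulr_ge0 ?ltW.
  rewrite exprMn exprVn exprMn sqr_sqrtr; last by rewrite mulr_ge0.
  have hu := central_bin_lower k : 2 / (pi * (2 * k).+1%:R) <= u ^+ 2.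
  (* Both parities of [m] are covered by [2 * m./2 <= m]. *)
  have hv : 2 / (pi * m.+1%:R) <= v ^+ 2.
    apply: le_trans (central_bin_lower _).
    rewrite ler_pM2l // lef_pV2 ?posrE ?mulr_gt0 // ler_pM2l // ler_nat.
    by have := odd_double_half m; lia.
  rewrite exprMn.
  have -> : 2 ^+ 2 / (pi ^+ 2 * ((2 * k).+1%:R * m.+1%:R)) =
     (2 / (pi * (2 * k).+1%:R)) * (2 / (pi * m.+1%:R)) :> R.
    have : pi != 0 :> R by rewrite gt_eqF.
    have : (2 * k).+1%:R != 0 :> R by rewrite pnatr_eq0.
    have : m.+1%:R != 0 :> R by rewrite pnatr_eq0.
    move: (pi) ((2 * k).+1%:R) (m.+1%:R) => x y z hz hy hx.
    by field; rewrite hx hy hz.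
  by apply: ler_pM => //; rewrite divr_ge0 // mulr_ge0 ?ltW.
(* From [j < 2 ^ j] with [j = m./2] comes [m <= 2 * 2 ^ j], hence [m ^ 2 <= 4 * 2 ^ m]. *)
have small : 2 ^- m <= 4 / m%:R ^+ 2 :> R.
  rewrite -[4 / _]invrK invf_div lef_pV2 ?posrE ?divr_gt0 ?exprn_gt0 ?ltr0n //.
  rewrite ler_pdivrMr // -natrX -[4]/(4%:R) -natrX -natrM ler_nat.
  have h1 := odd_double_half m; have h2 := ltn_expl m./2 (ltnSn 1).
  have h3 : ((2 ^ m./2) ^ 2 <= 2 ^ m)%N by rewrite -expnM leq_exp2l //; lia.
  have h4 : (m <= 2 * 2 ^ m./2)%N by lia.
  by nia.
have main : u * v - u * 2 ^- m <= (words n (last_balanced n k))%:R / 2 ^+ n.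
  have := words_last_balanced kn; rewrite -/m => h.
  have {}h : 'C(2 * k, k)%:R * (2 * 'C(m.-1, uphalf m.-1)%:R - 1) <=
      (words n (last_balanced n k))%:R :> R.
    apply: le_trans (_ :
      ('C(2 * k, k) * (2 * 'C(m.-1, uphalf m.-1) - 1))%:R <= _);
      last by rewrite ler_nat.
    rewrite natrM ler_pM2l ?ltr0n ?bin_gt0; last by lia.
    by rewrite lerBlDr -natrM -[X in _ + X]/(1%:R) -natrD ler_nat; lia.
  apply: le_trans (_ : 'C(2 * k, k)%:R *
    (2 * 'C(m.-1, uphalf m.-1)%:R - 1) / 2 ^+ n <= _); last first.
    by rewrite ler_pM2r ?invr_gt0 ?exprn_gt0.
  rewrite /v -half_central_bin // /u /central_bin (_ : n = 2 * k + m)%N; last by rewrite /m; lia.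
  rewrite exprD exprM (_ : 2 ^+ 2 = 4); last by ring.
  by rewrite le_eqVlt; apply/orP; left; apply/eqP; field; rewrite !expf_neq0.
apply: le_trans main; apply: lerB => //; apply: le_trans small.
by rewrite ler_piMl ?central_bin_le1 // invr_ge0 exprn_ge0.
Qed.
End luck_lower_bound.

(** * Increments of the arcsine distribution function *)

Section arcsine_cdf.
Context {R : realType}.

(** On the unit interval this is the distribution function minus 1/2; the shift cancels in
    differences. *)
Definition arcsine_cdf (x : R) : R := pi^-1 * asin (2 * x - 1).
Local Notation G := arcsine_cdf.

Lemma arcsine_cdf_homo c d : 0 < c -> c <= d -> d < 1 -> G c <= G d.
Proof.
move=> c0; rewrite le_eqVlt => /predU1P[->//|cd] d1.
rewrite -subr_ge0 -lee_fin -arcsine_prob_itv //; exact: measure_ge0.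
Qed.

Lemma arcsine_cdf_sub_le1 c d : 0 < c -> c < d -> d < 1 -> G d - G c <= 1.
Proof.
move=> c0 cd d1; rewrite -lee_fin -arcsine_prob_itv //; exact: probability_le1.
Qed.

(** On [[c, d]] the product [x * (1 - x)] is at least [c * (1 - d)], which bounds the density by a
    constant. *)
Lemma arcsine_cdf_sub_le c d : 0 < c -> c < d -> d < 1 ->
  G d - G c <= (d - c) / (pi * Num.sqrt (c * (1 - d))).
Proof.
move=> c0 cd d1; have p0 : 0 < pi :> R := pi_gt0 R.
have s0 : 0 < c * (1 - d) by rewrite mulr_gt0 ?subr_gt0.
rewrite -lee_fin -arcsine_prob_itv // /arcsine_prob.
apply: (@le_trans _ _ (\int[@lebesgue_measure R]_(x in `[c, d])
    ((pi * Num.sqrt (c * (1 - d)))^-1)%:E)%E).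
  apply: ge0_le_integral => //.
  - by move=> x _; rewrite lee_fin arcsine_pdf_ge0.
  - apply: measurable_funTS; apply: measurableT_comp => //; exact: measurable_arcsine_pdf.
  - move=> x /=; rewrite in_itv /= => /andP[cx xd]; rewrite lee_fin /arcsine_pdf.
    have -> : 0 < x < 1 by apply/andP; split; lra.
    have x0 : 0 < x * (1 - x) by rewrite mulr_gt0 //; lra.
    rewrite lef_pV2 ?posrE ?mulr_gt0 ?sqrtr_gt0 // ler_pM2l // ler_sqrt ?(ltW x0) //.
    by apply: ler_pM => //; lra.
rewrite integral_cst //= lebesgue_measure_itv /= lte_fin cd -EFinD -EFinM lee_fin.
by rewrite mulrC.
Qed.

(* The relative error comes from comparing (2k)(n - 2k - 2) with
   (2k + 1)(n - 2k + 1) under the square root, the absolute one from the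
   prefix consisting only of a's, which is still in the first phase. *)
Lemma arcsine_cdf_increment (a c : R) n k : (0 < k)%N -> ((2 * k).+2 < n)%N ->
  0 < a -> a * n%:R <= (2 * k)%:R -> 0 < c -> c * n%:R <= (n - 2 * k)%:R ->
  (1 - (a^-1 + 3 / c) / n%:R) * (G ((2 * k).+2%:R / n%:R) - G ((2 * k)%:R / n%:R))
    - (4 / c ^+ 2) / n%:R ^+ 2
  <= (words n (last_balanced n k))%:R / 2 ^+ n.
Proof.
move=> k0 kn a0 ak c0 ck.
have kn' : (2 * k < n)%N by lia.
have nn : (0 < n)%N by lia.
have n0 : 0 < n%:R :> R by rewrite ltr0n.
apply: le_trans (words_last_balanced_lower k0 kn'); apply: lerB; last first.
  rewrite -mulrA ler_pM2l // -invfM lef_pV2 ?posrE ?mulr_gt0 ?exprn_gt0 ?ltr0n ?subn_gt0 //.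
  by rewrite -exprMn ler_pXn2r ?nnegrE // mulr_ge0 ?ltW.
have p0 : 0 < pi :> R := pi_gt0 R.
have x0 : 0 < (2 * k)%:R :> R by rewrite ltr0n; lia.
have e1 : (2 * k).+1%:R = (2 * k)%:R + 1 :> R by rewrite natr1.
have e2 : (2 * k).+2%:R = (2 * k)%:R + 2 :> R by rewrite -natr1 e1; ring.
have e3 : (n - 2 * k)%:R = n%:R - (2 * k)%:R :> R by rewrite natrB // ltnW.
have e4 : (n - 2 * k).+1%:R = n%:R - (2 * k)%:R + 1 :> R by rewrite -natr1 e3.
have xn : (2 * k)%:R + 2 < n%:R :> R by rewrite -e2 ltr_nat.
rewrite e4 e1 e2; rewrite e3 in ck.
move: (2 * k)%:R n%:R n0 x0 xn ak ck {e1 e2 e3 e4} => x N N0 x0 xN ax cx.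
have cd : x / N < (x + 2) / N by rewrite ltr_pM2r ?invr_gt0 //; lra.
have d1 : (x + 2) / N < 1 by rewrite ltr_pdivrMr //; lra.
have inc := arcsine_cdf_sub_le (divr_gt0 x0 N0) cd d1.
(* [P] stems from the density bound on the increment, [Q] from the Wallis bound. *)
pose P := x * (N - x - 2); pose Q := (x + 1) * (N - x + 1).
have P0 : 0 < P by rewrite mulr_gt0 //; lra.
have Q0 : 0 < Q by rewrite mulr_gt0 //; lra.
have PQ : P <= Q by apply: ler_pM; lra.
have incE : ((x + 2) / N - x / N) / (pi * Num.sqrt (x / N * (1 - (x + 2) / N))) =
    2 / (pi * Num.sqrt P).
  have -> : x / N * (1 - (x + 2) / N) = P * (N^-1) ^+ 2.
    by rewrite /P; field; rewrite gt_eqF.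
  rewrite sqrtrM ?ltW // sqrtr_sqr ger0_norm ?invr_ge0 ?ltW //.
  have : Num.sqrt P != 0 by rewrite gt_eqF // sqrtr_gt0.
  have : pi != 0 :> R by rewrite gt_eqF.
  have : N != 0 by rewrite gt_eqF.
  move: pi (Num.sqrt P) => y z hN hy hz.
  by field; rewrite hN hy hz.
rewrite incE in inc.
(* [P / Q] factors as [(1 - u) * (1 - v)], which is at least [1 - u - v]. *)
have eta : 1 - (a^-1 + 3 / c) / N <= P / Q.
  pose u := (x + 1)^-1; pose v := 3 / (N - x + 1).
  have -> : P / Q = (1 - u) * (1 - v).
    by rewrite /P /Q /u /v; field; rewrite !gt_eqF //; lra.
  have hu : u <= a^-1 / N.
    by rewrite -invfM lef_pV2 ?posrE ?mulr_gt0 //; lra.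
  have hv : v <= 3 / c / N.
    by rewrite -mulrA ler_pM2l // -invfM lef_pV2 ?posrE ?mulr_gt0 //; lra.
  have u0 : 0 <= u by rewrite invr_ge0; lra.
  have v0 : 0 <= v by rewrite divr_ge0 //; lra.
  by have := mulr_ge0 u0 v0; rewrite mulrDl; lra.
have inc0 : 0 <= G ((x + 2) / N) - G (x / N).
  by rewrite subr_ge0 arcsine_cdf_homo ?divr_gt0 // ltW.
apply: (@le_trans _ _ (P / Q * (G ((x + 2) / N) - G (x / N)))).
  by rewrite ler_wpM2r.
apply: (@le_trans _ _ (P / Q * (2 / (pi * Num.sqrt P)))).
  by rewrite ler_wpM2l // divr_ge0 // ltW.
have sP : 0 < Num.sqrt P by rewrite sqrtr_gt0.
have sQ : 0 < Num.sqrt Q by rewrite sqrtr_gt0.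
have sPQ : Num.sqrt P <= Num.sqrt Q by rewrite ler_sqrt // ltW.
(* Of the two factors [sqrt P / sqrt Q] in [P / Q], one replaces [sqrt P] by [sqrt Q] in the
   denominator and the other is at most 1. *)
rewrite -/Q -{1}(sqr_sqrtr (ltW P0)) -{1}(sqr_sqrtr (ltW Q0)).
have -> : Num.sqrt P ^+ 2 / Num.sqrt Q ^+ 2 * (2 / (pi * Num.sqrt P)) =
   2 / (pi * Num.sqrt Q) * (Num.sqrt P / Num.sqrt Q).
  have : pi != 0 :> R by rewrite gt_eqF.
  move: pi => y hy.
  by field; rewrite hy !gt_eqF.
rewrite ler_piMr ?divr_ge0 ?mulr_ge0 ?(ltW p0) ?(ltW sQ) //.
by rewrite ler_pdivrMr // mul1r.
Qed.
End arcsine_cdf.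

(** * Summation over the positions of the last balanced suffix *)

Section luck.
Context {R : realType}.
Local Notation G := (@arcsine_cdf R).

(** The events for distinct [k] are disjoint, since each fixes a different value of
    [normalized_luck]; hence their counts add up. *)
Lemma sum_words_last_balanced n g (a b : R) K1 K2 : optimal_strategy n g ->
  (forall k, (K1 <= k < K2)%N ->
    (2 * k.+1 < n)%N /\ a < (2 * k.+1)%:R / n%:R <= b) ->
  (\sum_(K1 <= k < K2) words n (last_balanced n k.+1) <=
   #|[pred w : n.-tuple bool | (a < normalized_luck n R g w <= b)%R]|)%N.
Proof.
move=> hg hK; rewrite -sum1_card [leqRHS]big_mkcond.
under eq_bigr do rewrite wordsE.
rewrite exchange_big /=; apply: leq_sum => w _; rewrite inE.
have [/hasP[k0]|/hasPn none] := boolP (has (fun k => last_balanced n k.+1 w) (index_iota K1 K2)).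
  rewrite mem_index_iota => k0K lb0.
  have [k0n k0ab] := hK _ k0K.
  rewrite (normalized_luck_last_balanced R hg _ k0n lb0) // k0ab.
  rewrite (bigD1_seq k0) ?mem_index_iota ?iota_uniq //= lb0 big1_seq // => k /andP[kk0].
  rewrite mem_index_iota => kK; apply/eqP; rewrite eqb0; apply/negP => lb.
  have [kn _] := hK _ kK.
  have := normalized_luck_last_balanced R hg (ltn0Sn _) kn lb.
  rewrite (normalized_luck_last_balanced R hg _ k0n lb0) //.
  have n0 : (n%:R != 0 :> R) by rewrite pnatr_eq0; lia.
  move=> /(mulIf (invr_neq0 n0)) /eqP; rewrite eqr_nat => /eqP e.
  by move/eqP: kk0; apply; lia.
by rewrite big1_seq // => k /andP[_ /none /negbTE->].
Qed.

(** The increments telescope and all errors are of order [1 / n], with a constant depending on [a]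
    and [b] only. *)
Lemma normalized_luck_lower (a b : R) : 0 < a -> a < b -> b < 1 ->
  exists C : R, forall n g, optimal_strategy n g ->
    2 < (b - a) * n%:R -> 2 < (1 - b) * n%:R ->
    G b - G a - C / n%:R <=
    #|[pred w : n.-tuple bool | a < normalized_luck n R g w <= b]|%:R / 2 ^+ n.
Proof.
move=> a0 ab b1; pose c := 1 - b; have c0 : 0 < c by rewrite subr_gt0.
have p0 : 0 < pi :> R := pi_gt0 R.
pose M := (pi * Num.sqrt (a * c))^-1.
(* [2 * M] pays for the grid at the left endpoint, [a^-1 + 3 / c] for the relative errors (the
   increments sum to at most 1), and [4 / c ^+ 2] for at most [n] absolute errors of order
   [1 / n ^ 2]. *)
exists (2 * M + (a^-1 + 3 / c) + 4 / c ^+ 2) => n g hg nba nb1.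
have n0 : 0 < n%:R :> R.
  by rewrite ltr0n lt0n; apply/eqP => n0; move: nba; rewrite n0 mulr0; lra.
have b0 : 0 < b by lra.
(* The range [K1 <= k < K2] consists of the [k] with [a * n < 2 * (k + 1) <= b * n]. *)
pose K1 := Num.truncn (a * n%:R / 2); pose K2 := Num.truncn (b * n%:R / 2).
have /andP[K1l K1u] : K1%:R <= a * n%:R / 2 < K1.+1%:R.
  by apply: truncn_itv; rewrite divr_ge0 ?mulr_ge0 ?ltW.
have /andP[K2l K2u] : K2%:R <= b * n%:R / 2 < K2.+1%:R.
  by apply: truncn_itv; rewrite divr_ge0 ?mulr_ge0 ?ltW.
rewrite -[K1.+1%:R]natr1 in K1u; rewrite -[K2.+1%:R]natr1 in K2u.
have K12 : (K1 < K2)%N.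
  by rewrite -(ltr_nat R); lra.
have K_range k : (K1 <= k < K2)%N ->
    [/\ ((2 * k.+1).+2 < n)%N, a * n%:R < (2 * k.+1)%:R & (2 * k.+1)%:R <= b * n%:R].
  move=> /andP[k1 k2].
  have h1 : K1%:R + 1 <= k.+1%:R :> R by rewrite natr1 ler_nat.
  have h2 : k.+1%:R <= K2%:R :> R by rewrite ler_nat.
  have e : (2 * k.+1)%:R = 2 * k.+1%:R :> R by rewrite natrM.
  split; last 2 first.
  - by rewrite e; lra.
  - by rewrite e; lra.
  rewrite -(ltr_nat R) -natr1 -natr1 e; rewrite /c in c0; lra.
pose A k : R := (2 * k)%:R / n%:R.
have sum_le : (\sum_(K1 <= k < K2) words n (last_balanced n k.+1) <=
   #|[pred w : n.-tuple bool | (a < normalized_luck n R g w <= b)%R]|)%N.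
  apply: sum_words_last_balanced; first exact: hg.
  move=> k /K_range[kn ka kb].
  split; first exact: ltnW (ltnW kn).
  by rewrite ltr_pdivlMr // ka ler_pdivrMr.
apply: (@le_trans _ _
    ((\sum_(K1 <= k < K2) words n (last_balanced n k.+1))%:R / 2 ^+ n)); last first.
  by rewrite ler_pM2r ?invr_gt0 ?exprn_gt0 // ler_nat.
rewrite natr_sum mulr_suml.
apply: (@le_trans _ _ (\sum_(K1 <= k < K2) ((1 - (a^-1 + 3 / c) / n%:R) * (G (A k.+2) - G (A k.+1))
    - (4 / c ^+ 2) / n%:R ^+ 2))); last first.
  apply: ler_sum_nat => k /K_range[kn ka kb].
  have := @arcsine_cdf_increment R a c n k.+1; rewrite /A.
  rewrite (_ : 2 * k.+2 = (2 * k.+1).+2)%N; last by rewrite !mulnS.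
  apply=> //; first exact: ltW.
  rewrite natrB; last exact: ltnW (ltnW (ltnW kn)).
  by rewrite /c; lra.
rewrite big_split /= -mulr_sumr (telescope_sumr (fun k => G (A k.+1))) ?(ltnW K12) //.
rewrite sumr_const_nat.
have A1 : a < A K1.+1 by rewrite ltr_pdivlMr // natrM -natr1; lra.
have A1b : A K1.+1 < b by rewrite ltr_pdivrMr // natrM -natr1; nra.
have A2 : b < A K2.+1 by rewrite ltr_pdivlMr // natrM -natr1; lra.
have A21 : A K2.+1 < 1 by rewrite ltr_pdivrMr // natrM -natr1; nra.
have A1a : A K1.+1 - a <= 2 / n%:R.
  have e : (2 / n%:R + a) * n%:R = 2 + a * n%:R by field; rewrite gt_eqF.
  by rewrite lerBlDr ler_pdivrMr // e natrM -natr1; lra.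
(* The telescoped sum ends beyond [b], which only helps; it starts at most [2 / n] after [a], which
   costs at most [2 / n * M]. *)
have hb : G b <= G (A K2.+1) by rewrite arcsine_cdf_homo // ltW.
have ha : G (A K1.+1) - G a <= 2 / n%:R * M.
  apply: le_trans (arcsine_cdf_sub_le a0 A1 (lt_trans A1b b1)) _.
  have sc : 0 < Num.sqrt (a * c) by rewrite sqrtr_gt0 mulr_gt0.
  have scA : Num.sqrt (a * c) <= Num.sqrt (a * (1 - A K1.+1)).
    by rewrite ler_sqrt ?mulr_ge0 ?ler_pM2l //; rewrite /c; lra.
  apply: ler_pM => //; first by lra.
    by rewrite invr_ge0 mulr_ge0 ?sqrtr_ge0 // ltW.
  rewrite lef_pV2 ?posrE ?mulr_gt0 // ?ler_pM2l //.
  exact: lt_le_trans scA.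
have D1 : G (A K2.+1) - G (A K1.+1) <= 1.
  by apply: arcsine_cdf_sub_le1 => //; lra.
have eta0 : 0 <= (a^-1 + 3 / c) / n%:R.
  by rewrite divr_ge0 ?addr_ge0 ?divr_ge0 ?invr_ge0 ?ltW.
have K2n : (K2 - K1)%:R <= n%:R :> R.
  by rewrite natrB ?(ltnW K12) //; have : 0 <= K1%:R :> R by []; nra.
have err : 4 / c ^+ 2 / n%:R ^+ 2 * (K2 - K1)%:R <= 4 / c ^+ 2 / n%:R.
  have -> : 4 / c ^+ 2 / n%:R = 4 / c ^+ 2 / n%:R ^+ 2 * n%:R.
    by field; rewrite !gt_eqF.
  by rewrite ler_wpM2l // !divr_ge0 ?exprn_ge0 ?ltW.
rewrite mulNrn -[_ *+ (K2 - K1)]mulr_natr.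
have := ler_wpM2l eta0 D1; rewrite mulr1 => etaD.
have -> : (2 * M + (a^-1 + 3 / c) + 4 / c ^+ 2) / n%:R =
    2 / n%:R * M + (a^-1 + 3 / c) / n%:R + 4 / c ^+ 2 / n%:R.
  by rewrite [LHS]mulrDl mulrDl [2 * M / _]mulrAC.
move: etaD err ha hb; move: (_ / n%:R) (G _) (G _) (2 / _ * M) => eta GA2 GA1 x.
move: (G b) (G a) (_ * (K2 - K1)%:R) (_ / n%:R) => Gb Ga y z *; lra.
Qed.
End luck.

(** * Tightness inside the unit interval and convergence in distribution *)

Lemma arcsine_prob_tight (R : realType) (e : R) : 0 < e -> exists a b : R,
  [/\ 0 < a, a < b, b < 1 & ((1 - e)%:E <= arcsine_prob R `]a, b])%E].
Proof.
wlog e1 : e / e < 1 => [hwlog e0|e0].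
  have [/hwlog|e1] := ltP e 1; first exact.
  have [||a [b [a0 ab b1 h]]] := hwlog 2^-1; [by lra|by lra|].
  exists a, b; split => //; apply: le_trans h; rewrite lee_fin; lra.
have pi0 : 0 < pi :> R := pi_gt0 R.
(* The interval of radius [sin t / 2] around 1/2 has arcsine mass [2 * t / pi = 1 - e]. *)
pose t := pi / 2 * (1 - e).
have t0 : 0 < t by rewrite mulr_gt0 ?divr_gt0 ?subr_gt0.
have t1 : t < pi / 2 by rewrite gtr_pMr ?divr_gt0 //; lra.
have s0 : 0 < sin t by rewrite sin_gt0_pihalf // t0.
have s1 : sin t < 1.
  by rewrite -sin_pihalf ltr_sin ?in_itv /= ?lexx ?andbT; lra.
(* The left endpoint is moved further left so that the half-open interval contains the closed
   one. *)
exists ((1 - sin t) / 4), ((1 + sin t) / 2).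
have hE : arcsine_prob R `[(1 - sin t) / 2, (1 + sin t) / 2] = (1 - e)%:E.
  rewrite arcsine_prob_itv; [|lra|lra|lra].
  have -> : 2 * ((1 + sin t) / 2) - 1 = sin t by field.
  have -> : 2 * ((1 - sin t) / 2) - 1 = sin (- t) by rewrite sinN; field.
  rewrite !sinK ?in_itv /=; [|apply/andP; split; lra|apply/andP; split; lra].
  congr EFin; rewrite /t; have : pi != 0 :> R by rewrite gt_eqF.
  by move: pi => p hp; field.
split; [lra|lra|lra|].
rewrite -hE; apply: le_measure; rewrite ?inE //.
by move=> x /=; rewrite !in_itv /= => /andP[? ?]; apply/andP; split; lra.
Qed.

Section convergence.
Context {R : realType}.
Local Notation nu g n :=
  (distribution (word_prob R n) (normalized_luck n R (g n))).

Lemma luck_itv_lower (g : nat -> strategy) (a b e : R) :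
  (forall n : nat, optimal_strategy n (g n)) -> 0 < a -> a <= b -> b < 1 -> 0 < e ->
  \forall n \near \oo, (arcsine_prob R `]a, b] <= nu g n `]a, b] + e%:E)%E.
Proof.
move=> hg a0; rewrite le_eqVlt => /predU1P[<- _ e0|ab b1 e0].
  (* The empty interval is included because the intersections in [luck_lower] may be empty. *)
  by apply: nearW => n; rewrite set_itvoc0 !measure0 add0e lee_fin ltW.
have [C hC] := @normalized_luck_lower R a b a0 ab b1.
have large (x y : R) : 0 < x -> \forall n \near \oo, y < x * n%:R.
  move=> x0; near=> n; rewrite mulrC -ltr_pdivrMr //.
  by near: n; exact: nbhs_infty_gtr.
near=> n.
have n1 : 2 < (b - a) * n%:R by near: n; apply: large; rewrite subr_gt0.
have n2 : 2 < (1 - b) * n%:R by near: n; apply: large; rewrite subr_gt0.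
have n3 : C < e * n%:R by near: n; exact: large.
have n0 : 0 < n%:R :> R.
  by rewrite ltr0n lt0n; apply/eqP => n0; move: n1; rewrite n0 mulr0; lra.
have -> : nu g n `]a, b] = ((#|[pred w : n.-tuple bool |
    a < normalized_luck n R (g n) w <= b]|)%:R / 2 ^+ n)%:E.
  rewrite -word_probE /distribution /pushforward /=; congr (word_prob R n _).
apply: (@le_trans _ _ (arcsine_prob R `[a, b])).
  apply: le_measure; rewrite ?inE //.
  by move=> x /=; rewrite !in_itv /= => /andP[? ?]; apply/andP; split; lra.
rewrite arcsine_prob_itv // -EFinD lee_fin.
have := hC n (g n) (hg n) n1 n2; rewrite /arcsine_cdf => h.
have : C / n%:R <= e by rewrite ler_pdivrMr // ltW.
move: h; move: (_ / 2 ^+ n) (C / _) => p q; lra.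
Unshelve. all: by end_near. Qed.

(** Some []a, b]] inside the unit interval misses at most [e / 2] of the arcsine mass; on its
    intersection with [I] the interval bound loses another [e / 2]. *)
Lemma luck_lower (g : nat -> strategy) (I : set R) (e : R) :
  (forall n : nat, optimal_strategy n (g n)) -> measurable I -> 0 < e ->
  (forall a b : R, 0 < a -> a < b -> b < 1 ->
     exists c d : R, [/\ 0 < c, c <= d, d < 1 & I `&` `]a, b] = `]c, d]]) ->
  \forall n \near \oo, (arcsine_prob R I <= nu g n I + e%:E)%E.
Proof.
move=> hg mI e0 hI; have e2 : 0 < e / 2 by rewrite divr_gt0.
have [a [b [a0 ab b1 hab]]] := arcsine_prob_tight e2.
have [c [d [c0 cd d1 cdE]]] := hI _ _ a0 ab b1.
near=> n.
have h : (arcsine_prob R `]c, d] <= nu g n `]c, d] + (e / 2)%:E)%E.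
  by near: n; exact: luck_itv_lower.
have mab : measurable (`]a, b] : set R) by exact: measurable_itv.
have hC : (arcsine_prob R (~` `]a, b]) <= (e / 2)%:E)%E.
  have -> : arcsine_prob R (~` `]a, b]) = (1%:E - arcsine_prob R `]a, b])%E.
    exact: probability_setC.
  have fin : arcsine_prob R `]a, b] \is a fin_num by exact: fin_num_measure.
  by move: hab; rewrite -(fineK fin) -EFinB !lee_fin; lra.
have -> : e%:E = ((e / 2)%:E + (e / 2)%:E)%E by rewrite -EFinD -splitr.
apply: (@le_trans _ _ (arcsine_prob R (I `&` `]a, b]) + arcsine_prob R (~` `]a, b]))%E).
  apply: (@le_trans _ _ (arcsine_prob R ((I `&` `]a, b]) `|` ~` `]a, b]))).
    apply: le_measure; rewrite ?inE //.
      by apply: measurableU; [exact: measurableI|exact: measurableC].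
    move=> x Ix; have [xab|xab] := pselect (`]a, b]%classic x); first by left; split.
    by right.
  by apply: measureU2; [exact: measurableI|exact: measurableC].
rewrite [leRHS]addeA; apply: leeD => //; rewrite cdE; apply: le_trans h _.
apply: leeD => //.
apply: le_measure; rewrite ?inE //.
by rewrite -cdE; exact: subIsetl.
Unshelve. all: by end_near. Qed.

End convergence.

(** Asymptotic lower bounds on the two complementary half-lines at [x] suffice: both laws have total
    mass 1, so a lower bound on one half-line is an upper bound on the other. *)
Theorem theorem11 (R : realType) (g : nat -> strategy)
    (hg : forall n : nat, optimal_strategy n (g n)) :
  cvg_in_distribution
    (fun n : nat => distribution (word_prob R n) (normalized_luck n R (g n)))
    (arcsine_prob R).
Proof.
move=> x _; pose mu : probability R R := arcsine_prob R.
pose nu n : probability R R := distribution (word_prob R n) (normalized_luck n R (g n)).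
have lo e : 0 < e -> \forall n \near \oo,
    (mu `]-oo, x]%classic <= nu n `]-oo, x]%classic + e%:E)%E.
  move=> e0; apply: luck_lower => // a b a0 ab b1.
  (* The outer maximum makes the interval empty when [x <= a]; the minimum with [b] in the other
     half plays the same role. *)
  exists a, (Num.max a (Num.min x b)); split=> //.
  - by rewrite le_max lexx.
  - by rewrite gt_max (lt_trans ab b1) /= gt_min b1 orbT.
  - apply/seteqP; split=> y /=; rewrite !in_itv /= le_max le_min.
      by move=> [yx /andP[ay yb]]; rewrite ay yx yb orbT.
    move=> /andP[ay /orP[ya|/andP[yx yb]]]; first by lra.
    by rewrite ay yx yb.
have hi e : 0 < e -> \forall n \near \oo,
    (mu `]x, +oo[%classic <= nu n `]x, +oo[%classic + e%:E)%E.
  move=> e0; apply: luck_lower => // a b a0 ab b1.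
  exists (Num.min b (Num.max a x)), b; split=> //.
  - by rewrite lt_min (lt_trans a0 ab) /= lt_max a0.
  - by rewrite ge_min lexx.
  - apply/seteqP; split=> y /=; rewrite !in_itv /= andbT gt_min gt_max.
      by move=> [xy /andP[ay yb]]; rewrite ay xy yb orbT.
    move=> /andP[/orP[yb'|/andP[ay xy]] yb]; first by lra.
    by rewrite ay xy yb.
have finE (m : probability R R) (A : set R) : measurable A -> m A = (fine (m A))%:E.
  by move=> mA; rewrite fineK // fin_num_measure.
have hiE (m : probability R R) :
    m `]x, +oo[%classic = (1 - fine (m `]-oo, x]%classic))%:E.
  by rewrite -setCitvl probability_setC // [X in (_ - X)%E]finE.
change (nu n `]-oo, x]%classic @[n --> \oo] --> mu `]-oo, x]%classic).
pose A : set R := `]-oo, x]%classic; have mA : measurable A by exact: measurable_itv.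
rewrite -/A (finE mu A) //; under eq_fun do rewrite (finE (nu _) A) //.
apply: cvg_EFin; first by near=> n.
apply/cvgrPdist_le => /= e e0; near=> n.
have : (mu `]-oo, x]%classic <= nu n `]-oo, x]%classic + e%:E)%E by near: n; exact: lo.
have : (mu `]x, +oo[%classic <= nu n `]x, +oo[%classic + e%:E)%E by near: n; exact: hi.
rewrite !hiE -/A (finE mu A) // (finE (nu n) A) // -!EFinD !lee_fin => h1 h2.
rewrite ler_norml; apply/andP; split; lra.
Unshelve. all: by end_near. Qed.
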